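(* Let $k=p^\alpha$, where $p$ is an odd prime and $\alpha\in\mathbb{Z}_{\ge 1}$. Let $A$ be a finite set of integers such that $|A|>8k^k$. Then \[|2\cdot A+k\cdot A|\ge (k+2)|A|-k^2-k+2.\]
   Context: For an integer $m$ and a set $A$ of integers, $m\cdot A=\{ma : a\in A\}$ denotes the $m$-dilation of $A$. Sums of sets are Minkowski sums, so $2\cdot A+k\cdot A=\{2a_1+ka_2 : a_1,a_2\in A\}$. $|S|$ denotes the cardinality of a finite set $S$. *)

(* Defs.v *)
From mathcomp Require Import all_boot all_order all_algebra.
From mathcomp Require Import finmap.

Set Implicit Arguments.
Unset Strict Implicit.
Unset Printing Implicit Defensive.

Import Order.TTheory GRing.Theory Num.Theory.

Local Open Scope ring_scope.

Definition dilate (m : int) (A : {fset int}) : {fset int} :=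
  [fset (m * a)%R | a in A]%fset.

Definition sumset (A B : {fset int}) : {fset int} :=
  [fset (a + b)%R | a in A, b in B]%fset.

(* Main.v *)
Require Import Defs.
From mathcomp Require Import all_boot all_order all_algebra.
From mathcomp Require Import finmap.
From mathcomp Require Import zify ring.

Set Implicit Arguments.
Unset Strict Implicit.
Unset Printing Implicit Defensive.

Import Order.TTheory GRing.Theory Num.Theory.

Local Open Scope ring_scope.

(** Let [f A] be the size of [2 * A + k * A]. Split [A] into its [j] nonempty
    classes modulo [k], and write the class of [r] as [k * X_r + r]. As [k] is
    odd, the sums [2 * (k * X_r + r) + k * A] lie in distinct classes modulo [k],
    and they are affine images of the sets [2 * X_r + A]; so [f A] is the sum of
    the sizes of the [2 * X_r + A] ([card_sum2k]). An affine change of variable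
    makes [A] nonconstant modulo 2 and modulo [p] ([aff_normal]). Then [A] has two
    parity classes, each [2 * X_r + A] has at least [|A| + 2 |X_r| - 2] elements,
    and [f A >= (j + 2) |A| - 2 j], which is enough when [j = k].

    When [j < k] one compares [2 * X_r + A] with the part [2 * X_r + k * X_r + r]
    that comes from the class of [r] itself. That part has [f X_r] elements, which
    invites an induction, and the rest of [2 * X_r + A] is a gain.
    - If [X_r] misses a residue modulo [k], the gain is at least the size of any
      class of [A] whose residue [q] has [q - r] prime to [p]
      ([card_sumset_not_full]). This is where [k] has to be a prime power: such a
      difference generates the residues modulo [k].
    - If [X_r] meets all residues, then [f X_r >= (k + 2) |X_r| - 2 k], and extreme
      elements of the other classes yield a few more sums
      ([card_sumset_extremes]).

    The induction first gives [f A >= (k + 2) |A| - E] for every finite [A], with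
    a constant [E] depending only on [k] ([weak_bound]); the coefficient is raised
    one unit at a time from 4 to [k + 2], each time from the previous bound for
    the sets [X_r].

    Suppose now that [A] is large. If some [X_r] misses a residue, the bound with
    error [E] for each class, together with a gain proportional to [|A|], gives
    [f A >= (k + 2) |A|] ([card_sum2k_not_full_class]). If no [X_r] does, the
    extreme elements bring the total loss from [2 k j] down to [j (2 k + 1 - j)],
    and for [j <= k - 1] this is at most [(k - 1) (k + 2) = k^2 + k - 2]
    ([card_sum2k_full_classes]). *)

(** * Counting in finite sets *)

Lemma card_fibers (I : finType) (T : choiceType) (P : pred I)
    (U : I -> {fset T}) (S : {fset T}) :
  (forall i, P i -> U i `<=` S)%fset ->
  (\sum_(i | P i) #|` U i| = \sum_(x <- S) \sum_(i | P i) (x \in U i))%N.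
Proof.
move=> US; rewrite exchange_big; apply: eq_bigr => i Pi.
rewrite card_fset_sum1 -big_mkcond /= [RHS]big_fset_condE.
apply: eq_fbigl => x; rewrite !inE /= andb_idl //.
exact: (fsubsetP (US i Pi)).
Qed.

Lemma sum_card_disjoint (I : finType) (T : choiceType) (P : pred I)
    (U : I -> {fset T}) (S : {fset T}) :
  (forall i, P i -> U i `<=` S)%fset ->
  (forall i j x, P i -> P j -> x \in U i -> x \in U j -> i = j) ->
  (\sum_(i | P i) #|` U i| <= #|` S|)%N.
Proof.
move=> US disjU; rewrite (card_fibers US) card_fset_sum1.
apply: leq_sum => x _.
case: (pickP (fun i => P i && (x \in U i))) => [i /andP[Pi xUi] | noU].
  rewrite (bigD1 i) //= big1 ?addn0 ?leq_b1 // => j /andP[Pj /negP ji].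
  by case xUj: (x \in U j) => //; case: ji; rewrite (disjU j i x).
by rewrite big1 // => i Pi; have := noU i; rewrite Pi /= => ->.
Qed.

Lemma card_le_sum_cover (I : finType) (T : choiceType) (U : I -> {fset T})
    (S : {fset T}) :
  (forall x, x \in S -> exists i, x \in U i) ->
  (#|` S| <= \sum_i #|` U i|)%N.
Proof.
move=> cov.
have US i : true -> (U i `&` S `<=` S)%fset by rewrite fsubsetIr.
apply: (@leq_trans (\sum_i #|` (U i `&` S)%fset|)); last first.
  by apply: leq_sum => i _; rewrite fsubset_leq_card ?fsubsetIl.
rewrite (card_fibers US) card_fset_sum1 big_seq [leqRHS]big_seq.
apply: leq_sum => x xS; have [i xUi] := cov x xS.
by rewrite (bigD1 i) //= inE xUi xS.
Qed.

Lemma leq_add_disjoint (T : choiceType) (U V S : {fset T}) :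
  (U `<=` S)%fset -> (V `<=` S)%fset ->
  (forall x, x \in U -> x \in V -> False) -> (#|` U| + #|` V| <= #|` S|)%N.
Proof.
move=> US VS dUV; rewrite -cardfsUI.
have -> : (U `&` V = fset0)%fset.
  apply/fsetP => x; rewrite !inE; apply/negP => /andP[xU xV].
  exact: dUV xU xV.
by rewrite cardfs0 addn0 fsubset_leq_card // fsubUset US.
Qed.

Lemma leq_sum_affine (I : finType) (P : pred I) (F G : I -> nat) a b c :
  (forall i, P i -> a + b * F i <= G i + c)%N ->
  (#|P| * a + b * (\sum_(i | P i) F i) <= \sum_(i | P i) G i + #|P| * c)%N.
Proof.
move=> FG; rewrite big_distrr /= -!sum_nat_const -!big_split /=.
exact: leq_sum.
Qed.

(** Applied below to the strict order of the least, or of the greatest, elements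
    of the classes: each pair of classes is counted exactly once. *)
Lemma sum_card_tournament (I : finType) (P : pred I) (R : rel I) :
  (forall i m, P i -> P m -> R m i + R i m + (m == i) = 1)%N ->
  (2 * (\sum_(i | P i) #|[pred m | P m && R m i]|) + #|P| = #|P| * #|P|)%N.
Proof.
move=> tourn.
have cardR i : #|[pred m | P m && R m i]| = (\sum_(m | P m) R m i)%N.
  by rewrite -sum1_card big_mkcondr; apply: eq_bigr => m _; case: (R m i).
under eq_bigr => i _ do rewrite cardR.
rewrite mul2n -addnn {2}exchange_big /= -big_split /= -{1}sum1_card -big_split /=.
rewrite -sum_nat_const; apply: eq_bigr => i Pi.
have diag : (\sum_(m | P m) (m == i) = 1)%N.
  by rewrite (bigD1 i) //= eqxx big1 // => m /andP[_ /negbTE ->].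
rewrite -big_split -diag -big_split -[RHS]sum1_card.
by apply: eq_bigr => m Pm; apply: tourn.
Qed.

Lemma fset_min (A : {fset int}) :
  A != fset0 -> exists2 a, a \in A & forall b, b \in A -> a <= b.
Proof.
case/fset0Pn => a0 a0A.
have [a _ amin] := arg_minP (fun a : A => val a) (erefl true : xpredT [`a0A]%fset).
exists (val a) => [|b bA]; first exact: valP.
exact: (amin [`bA]%fset).
Qed.

Lemma fset_max (A : {fset int}) :
  A != fset0 -> exists2 a, a \in A & forall b, b \in A -> b <= a.
Proof.
case/fset0Pn => a0 a0A.
have [a _ amax] := arg_maxP (fun a : A => val a) (erefl true : xpredT [`a0A]%fset).
exists (val a) => [|b bA]; first exact: valP.
exact: (amax [`bA]%fset).
Qed.

(** * Sums and affine images *)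

Lemma mem_sumset (A B : {fset int}) a b :
  a \in A -> b \in B -> a + b \in sumset A B.
Proof. by move=> aA bB; apply: in_imfset2. Qed.

Lemma sumsetP (A B : {fset int}) z :
  reflect (exists a b, [/\ a \in A, b \in B & z = a + b]) (z \in sumset A B).
Proof.
apply: (iffP (imfset2P _ _ _ _ _)) => [[a aA [b bB ->]] | [a [b [aA bB ->]]]].
  by exists a, b.
by exists a => //; exists b.
Qed.

Lemma mem_dilate (m : int) (A : {fset int}) a :
  a \in A -> m * a \in dilate m A.
Proof. by move=> aA; apply: in_imfset. Qed.

Lemma dilateP (m : int) (A : {fset int}) z :
  reflect (exists2 a, a \in A & z = m * a) (z \in dilate m A).
Proof. exact: imfsetP. Qed.

Definition aff (g b : int) (A : {fset int}) : {fset int} :=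
  [fset (g * a + b)%R | a in A]%fset.

Lemma affP (g b : int) (A : {fset int}) z :
  reflect (exists2 a, a \in A & z = g * a + b) (z \in aff g b A).
Proof. exact: imfsetP. Qed.

Lemma mem_aff (g b : int) (A : {fset int}) a :
  a \in A -> g * a + b \in aff g b A.
Proof. by move=> aA; apply/affP; exists a. Qed.

Lemma card_aff (g b : int) (A : {fset int}) : g != 0 -> #|` aff g b A| = #|` A|.
Proof.
move=> g0; rewrite card_imfset // => x y /= /addIr; exact: mulfI.
Qed.

Lemma card_dilate (m : int) (A : {fset int}) :
  m != 0 -> #|` dilate m A| = #|` A|.
Proof. by move=> m0; rewrite card_imfset //; apply: mulfI. Qed.

Lemma sumset_sub (A A' B B' : {fset int}) :
  (A `<=` A')%fset -> (B `<=` B')%fset -> (sumset A B `<=` sumset A' B')%fset.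
Proof.
move=> /fsubsetP sA /fsubsetP sB; apply/fsubsetP => z /sumsetP[a [b [aA bB ->]]].
by rewrite mem_sumset ?sA ?sB.
Qed.

Lemma dilate_neq0 (m : int) (A : {fset int}) :
  A != fset0 -> dilate m A != fset0.
Proof. by case/fset0Pn => a aA; apply/fset0Pn; exists (m * a); apply: mem_dilate. Qed.

(** The translates of one summand by the largest, and of the other by the
    smallest, element of its partner have a single common point. *)
Lemma card_sumset (A B : {fset int}) :
  A != fset0 -> B != fset0 -> (#|` A| + #|` B| <= #|` sumset A B| + 1)%N.
Proof.
move=> /fset_min[a aA amin] /fset_max[b bB bmax].
rewrite -(@card_aff 1 b A) // -(@card_aff 1 a B) // -cardfsUI.
apply: leq_add; last first.
  rewrite -(cardfs1 (a + b)); apply/fsubset_leq_card/fsubsetP => z.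
  rewrite !inE => /andP[/affP[x xA ->] /affP[y yB]].
  have := amin x xA; have := bmax y yB; lia.
apply: fsubset_leq_card; rewrite fsubUset; apply/andP; split; apply/fsubsetP => z.
  by move=> /affP[x xA ->]; rewrite mul1r mem_sumset.
by move=> /affP[x xA ->]; rewrite mul1r addrC mem_sumset.
Qed.

Lemma dvdz_sub (d x y z : int) :
  (d %| x)%Z -> (d %| y)%Z -> z = x - y -> (d %| z)%Z.
Proof. by move=> dx dy ->; rewrite rpredB. Qed.

Definition spread (q : nat) (A : {fset int}) : Prop :=
  exists a b, [/\ a \in A, b \in A & ~~ (q%:Z %| a - b)%Z].

Lemma spread_other q A u : spread q A -> exists2 a, a \in A & ~~ (q%:Z %| a - u)%Z.
Proof.
move=> [a [b [aA bA ab]]]; have [au|] := boolP (q%:Z %| a - u)%Z; last by exists a.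
exists b => //; apply: contra ab => bu.
by apply: dvdz_sub au bu _; ring.
Qed.

(** Both parity classes of the second summand contribute separately, and each
    satisfies the bound [card_sumset]. *)
Lemma card_sumset_parity (X Y : {fset int}) :
  X != fset0 -> spread 2 Y ->
  (#|` Y| + 2 * #|` X| <= #|` sumset (dilate 2 X) Y| + 2)%N.
Proof.
move=> X0 Ysp.
pose Yp u := [fset y in Y | (2 %| y - u)%Z]%fset.
have Yp0 u : Yp u != fset0.
  have [y yY yu] := spread_other (u + 1) Ysp.
  by apply/fset0Pn; exists y; rewrite !inE /= yY /=; lia.
have YpS u : (Yp u `<=` Y)%fset by apply/fsubsetP => y; rewrite !inE => /andP[].
have bnd u := card_sumset (dilate_neq0 2 X0) (Yp0 u).
have cY : (#|` Y| <= #|` Yp 0| + #|` Yp 1|)%N.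
  rewrite -cardfsUI; apply: leq_trans (leq_addr _ _).
  apply/fsubset_leq_card/fsubsetP => y yY; rewrite !inE /= yY /=; lia.
have disj : (#|` sumset (dilate 2 X) (Yp 0)| + #|` sumset (dilate 2 X) (Yp 1)|
    <= #|` sumset (dilate 2 X) Y|)%N.
  apply: leq_add_disjoint; rewrite ?sumset_sub // => z.
  move=> /sumsetP[_ [y [/dilateP[x _ ->] yY ->]]].
  move=> /sumsetP[_ [y' [/dilateP[x' _ ->] yY']]].
  move: yY yY'; rewrite !inE /= => /andP[_ h1] /andP[_ h2]; lia.
move: (bnd 0) (bnd 1) cY disj; rewrite card_dilate //.
move: #|` Yp 0| #|` Yp 1| #|` sumset _ (Yp 0)| #|` sumset _ (Yp 1)|.
by move=> a b c d; lia.
Qed.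

(** Divide the differences to a base point by their greatest common divisor: a
    common residue of the quotients modulo [q] would be the residue 0 of the base
    point, and [q] would enlarge that divisor. *)
Lemma aff_normal (A : {fset int}) :
  (1 < #|` A|)%N ->
  exists g b A', [/\ g != 0, A = aff g b A' & forall q, (1 < q)%N -> spread q A'].
Proof.
move=> cA.
have [b bA] : exists b, b \in A by apply/fset0Pn; rewrite -cardfs_gt0 ltnW.
pose g := (\big[gcdn/0%N]_(a : A) `|val a - b|)%N.
have gdvd a : a \in A -> (g%:Z %| a - b)%Z.
  by move=> aA; apply: (@biggcdn_inf _ [`aA]%fset).
have g0 : g%:Z != 0.
  apply/eqP => g0; suff /fsubset_leq_card : (A `<=` [fset b])%fset.
    by rewrite cardfs1 leqNgt cA.
  apply/fsubsetP => a /gdvd; rewrite g0 inE dvd0z; lia.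
exists g%:Z, b, [fset ((a - b) %/ g%:Z)%Z | a in A]%fset; split => // [|q q1].
  apply/fsetP => a; apply/idP/affP => [aA | [_ /imfsetP[a' /= a'A ->] ->]].
    by exists ((a - b) %/ g)%Z; [apply/imfsetP; exists a | rewrite mulrC divzK ?gdvd // subrK].
  by rewrite mulrC divzK ?gdvd // subrK.
have : ~~ (g * q %| g)%N.
  by apply/negP => /dvdn_leq; have : (0 < g)%N by [lia]; nia.
move=> /dvdn_biggcdP nall.
have [a aA na] : exists2 a, a \in A & ~~ (g * q %| `|a - b|)%N.
  have [|/existsPn nex] := boolP [exists a : A, ~~ (g * q %| `|val a - b|)%N].
    by case/existsP => a na; exists (val a); rewrite ?(valP a).
  by case: nall => a _; have := nex a; rewrite negbK.
exists ((a - b) %/ g)%Z, ((b - b) %/ g)%Z; split.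
- by apply/imfsetP; exists a.
- by apply/imfsetP; exists b.
rewrite subrr div0z subr0; apply: contra na => /dvdzP[c ac].
have -> : (a - b) = c * (g * q)%N%:Z by rewrite -(divzK (gdvd a aA)) ac PoszM; ring.
by rewrite abszM dvdn_mull.
Qed.

(** * The error of the weak bound *)

(** The error for the coefficient [t + 4]. In the passage to the coefficient
    [t + 5] there are at most [t + 2] classes to consider, and each loses the
    current error at most twice, one of them only once: this is the factor
    [2 * t + 3]. The initial 6 is the smallest start for which [weak_error_ge]
    holds; that bound covers the loss [2 * k] of the classes that meet all
    residues. *)
Definition weak_error (t : nat) : nat := 6 * \prod_(s < t) (2 * s + 3).

Lemma weak_errorS t : weak_error t.+1 = (weak_error t * (2 * t + 3))%N.
Proof. by rewrite /weak_error big_ord_recr mulnA. Qed.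

Lemma weak_error_ge t : (2 * t + 6 <= weak_error t)%N.
Proof.
elim: t => [|t IHt]; first by rewrite /weak_error big_ord0.
by rewrite weak_errorS; nia.
Qed.

(** The step is the Bernoulli inequality
    [(t + 3) ^ (t + 1) >= (t + 2) ^ (t + 1) + (t + 1) * (t + 2) ^ t]. With
    [t = k - 2] this is what the size [8 * k ^ k] of [A] has to beat. *)
Lemma weak_error_le t : (weak_error t <= 8 * (t + 2) ^ t)%N.
Proof.
elim: t => [|t IHt]; first by rewrite /weak_error big_ord0.
have bernoulli n : ((t + 2) ^ n + n * (t + 2) ^ n.-1 <= (t + 3) ^ n)%N.
  elim: n => [|[|n] IHn]; rewrite ?expn0 ?expn1 //=; first by lia.
  by move: IHn; rewrite /= !(expnS _ n.+1) (expnS (t + 2) n); nia.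
rewrite weak_errorS addSnnS; have := bernoulli t.+1; rewrite expnS /=; nia.
Qed.

(** * Residue classes *)

(** The set written [X_r] in the introduction, for the ambient set [X]: see
    [mem_cl]. *)
Definition cl (k : nat) (r : int) (X : {fset int}) : {fset int} :=
  [fset ((x - r) %/ k%:Z)%Z | x in [fset x in X | (k%:Z %| x - r)%Z]]%fset.

Section Residues.

Variable k : nat.
Hypothesis k_odd : odd k.

Local Notation sum2k X Y := (sumset (dilate 2 X) (dilate k%:Z Y)).

Let k0 : k%:Z != 0. Proof. by case: k k_odd. Qed.

Lemma mem_cl r X z : (z \in cl k r X) = (k%:Z * z + r \in X).
Proof.
apply/imfsetP/idP => /= [[x xin ->] | zX].
  by move: xin; rewrite !inE /= => /andP[xX xr]; rewrite mulrC divzK // subrK.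
exists (k%:Z * z + r); last by rewrite addrK mulKz.
by rewrite !inE /= zX addrK dvdz_mulr.
Qed.

Lemma aff_cl_sub r X : (aff k%:Z r (cl k r X) `<=` X)%fset.
Proof. by apply/fsubsetP => w /affP[z zX ->]; rewrite -mem_cl. Qed.

Lemma cl_neq0P r X :
  reflect (exists2 x, x \in X & (k%:Z %| x - r)%Z) (cl k r X != fset0).
Proof.
apply: (iffP (fset0Pn _)) => [[z zX] | [x xX /dvdzP[z xr]]].
  by move: zX; rewrite mem_cl => zX; exists (k%:Z * z + r); rewrite // addrK dvdz_mulr.
by exists z; rewrite mem_cl mulrC -xr subrK.
Qed.

Lemma ord_residue (x : int) : exists r : 'I_k, (k%:Z %| x - r%:Z)%Z.
Proof.
have kp : (0 < k)%N by case: k k_odd.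
have lt_r : (`|(x %% k)%Z| < k)%N.
  have := modz_ge0 x k0; have := ltz_pmod x (_ : 0 < k%:Z); lia.
exists (Ordinal lt_r); rewrite /= gez0_abs ?modz_ge0 //.
by rewrite {1}(divz_eq x k) addrK dvdz_mull.
Qed.

(** The factor 2 is where the parity of [k] enters: it is what keeps the sums of
    distinct classes in distinct classes. *)
Lemma ord_residue_inj (r s : 'I_k) : (k%:Z %| 2 * r%:Z - 2 * s%:Z)%Z -> r = s.
Proof.
rewrite -mulrBr Gauss_dvdzr; last by rewrite coprimezE /= coprimen2.
by rewrite -eqz_mod_dvd !modz_small ?ltz_nat ?ltn_ord // => /eqP[] /val_inj.
Qed.

Lemma sum_card_cl X : (\sum_(r < k) #|` cl k r X| = #|` X|)%N.
Proof.
under eq_bigr => r _ do rewrite -(card_aff r%:Z _ k0).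
apply/eqP; rewrite eqn_leq; apply/andP; split.
  apply: sum_card_disjoint => [r _ | r s z _ _ /affP[x _ ->] /affP[y _ E]].
    exact: aff_cl_sub.
  apply: ord_residue_inj; apply/dvdzP; exists (2 * (y - x)).
  by move: E; set a := k%:Z; nia.
apply: card_le_sum_cover => x xX; have [r /dvdzP[z xr]] := ord_residue x.
exists r; apply/affP; exists z; last by rewrite mulrC -xr subrK.
by rewrite mem_cl mulrC -xr subrK.
Qed.

(** The [k * Y] part does not change residues modulo [k], and doubling permutes
    them, so the sum splits along the residue classes of [X]. *)
Lemma card_sum2k X Y :
  (#|` sum2k X Y| = \sum_(r < k) #|` sumset (dilate 2 (cl k r X)) Y|)%N.
Proof.
under eq_bigr => r _ do rewrite -(card_aff (2 * r%:Z) _ k0).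
apply/eqP; rewrite eqn_leq; apply/andP; split.
  apply: card_le_sum_cover => _ /sumsetP[_ [_ [/dilateP[x xX ->] /dilateP[y yY ->] ->]]].
  have [r /dvdzP[z xr]] := ord_residue x.
  exists r; apply/affP; exists (2 * z + y).
    by rewrite mem_sumset ?mem_dilate // mem_cl mulrC -xr subrK.
  have -> : x = k%:Z * z + r by rewrite mulrC -xr subrK.
  by ring.
apply: sum_card_disjoint => [r _ | r s z _ _ /affP[x _ ->] /affP[y _ E]].
  apply/fsubsetP => w /affP[_ /sumsetP[_ [y [/dilateP[z zX ->] yY ->]]] ->].
  rewrite mem_cl in zX.
  have -> : k%:Z * (2 * z + y) + 2 * r%:Z = 2 * (k%:Z * z + r) + k%:Z * y by ring.
  by rewrite mem_sumset ?mem_dilate.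
apply: ord_residue_inj; apply/dvdzP; exists (y - x).
by move: E; set a := k%:Z; nia.
Qed.

(** Both summands undergo the same change of variable, so [f] is an affine
    invariant. *)
Lemma sum2k_aff g b X Y :
  sum2k (aff g b X) (aff g b Y) = aff g ((2 + k%:Z) * b) (sum2k X Y).
Proof.
apply/fsetP => z; apply/sumsetP/affP.
  move=> [_ [_ [/dilateP[_ /affP[x xX ->] ->] /dilateP[_ /affP[y yY ->] ->] ->]]].
  exists (2 * x + k%:Z * y); last by ring.
  by rewrite mem_sumset ?mem_dilate.
move=> [_ /sumsetP[_ [_ [/dilateP[x xX ->] /dilateP[y yY ->] ->]]] ->].
exists (2 * (g * x + b)), (k%:Z * (g * y + b)).
by rewrite !mem_dilate ?mem_aff //; split => //; ring.
Qed.

Lemma card_sumset_aff q X Y :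
  #|` sumset X (aff k%:Z q Y)| = #|` sumset X (dilate k%:Z Y)|.
Proof.
rewrite -(@card_aff 1 q (sumset X (dilate _ _))) //; congr #|` _|.
apply/fsetP => z; apply/sumsetP/affP.
  move=> [x [_ [xX /affP[y yY ->] ->]]].
  exists (x + k%:Z * y); last by ring.
  by rewrite mem_sumset ?mem_dilate.
move=> [_ /sumsetP[x [_ [xX /dilateP[y yY ->] ->]]] ->].
by exists x, (k%:Z * y + q); rewrite mem_aff //; split => //; ring.
Qed.

Lemma card_sumset_cl X Y q :
  (#|` sum2k X (cl k q Y)| <= #|` sumset (dilate 2 X) Y|)%N.
Proof.
rewrite -(card_sumset_aff q); apply/fsubset_leq_card/sumset_sub => //.
exact: aff_cl_sub.
Qed.

(** * Sets that meet all residue classes, and sets that miss one *)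

Definition occupied (A : {fset int}) : pred 'I_k := [pred r : 'I_k | cl k r A != fset0].

Definition nclasses (A : {fset int}) : nat := #|occupied A|.

Definition full (X : {fset int}) : bool := [forall r, occupied X r].

Lemma fullP X :
  reflect (forall y : int, exists2 x, x \in X & (k%:Z %| x - y)%Z) (full X).
Proof.
apply: (iffP forallP) => [fX y | fX r]; last by apply/cl_neq0P/fX.
have [r yr] := ord_residue y.
have /cl_neq0P[x xX xr] := fX r.
by exists x => //; apply: dvdz_sub xr yr _; ring.
Qed.

Lemma sum_card_occupied A : (\sum_(r | occupied A r) #|` cl k r A| = #|` A|)%N.
Proof.
rewrite -(sum_card_cl A) [RHS](bigID (occupied A)) /= [X in (_ + X)%N]big1 ?addn0 //.
by move=> r; rewrite negbK => /eqP ->; rewrite cardfs0.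
Qed.

Lemma leq_sum_occupied A (G : 'I_k -> nat) a b c :
  (forall r, occupied A r -> a + b * #|` cl k r A| <= G r + c)%N ->
  (nclasses A * a + b * #|` A| <= \sum_(r | occupied A r) G r + nclasses A * c)%N.
Proof. by move=> AG; rewrite -sum_card_occupied; apply: leq_sum_affine. Qed.

Lemma leq_sum_residues X (G : 'I_k -> nat) a b c :
  (forall r : 'I_k, a + b * #|` cl k r X| <= G r + c)%N ->
  (k * a + b * #|` X| <= \sum_(r < k) G r + k * c)%N.
Proof.
move=> XG; rewrite -(sum_card_cl X).
have := @leq_sum_affine _ xpredT _ G _ _ _ (fun r _ => XG r).
by rewrite cardT size_enum_ord.
Qed.

Lemma sum_occupied_leq A X Y :
  (\sum_(r | occupied A r) #|` sumset (dilate 2 (cl k r X)) Y| <= #|` sum2k X Y|)%N.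
Proof. by rewrite (card_sum2k X) [leqRHS](bigID (occupied A)) leq_addr. Qed.

(** Each of the sets [2 * X_r + A] whose sizes add up to [f A] is bounded by
    [card_sumset_parity]. *)
Lemma card_sum2k_occupied A :
  spread 2 A ->
  (nclasses A * #|` A| + 2 * #|` A| <= #|` sum2k A A| + 2 * nclasses A)%N.
Proof.
move=> Asp.
have bnd r : occupied A r ->
    (#|` A| + 2 * #|` cl k r A| <= #|` sumset (dilate 2 (cl k r A)) A| + 2)%N.
  by move=> Ar; apply: card_sumset_parity.
have := leq_sum_occupied bnd; have := sum_occupied_leq A A A.
lia.
Qed.

Lemma leq_card_full X : full X -> (k <= #|` X|)%N.
Proof.
move=> /forallP fX; rewrite -(sum_card_cl X) -{1}(card_ord k) -sum1_card.
by apply: leq_sum => r _; rewrite cardfs_gt0; apply: fX.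
Qed.

(** An image that meets the residues of both [b] and [b + 1] forces [g] to be
    invertible modulo [k]. *)
Lemma full_aff g b X : full (aff g b X) -> full X.
Proof.
move=> /fullP fX.
have g_cop : coprimez k g.
  have [_ /affP[x xX ->] /dvdzP[c E]] := fX (b + 1).
  by apply/coprimezP; exists (- c, x); rewrite /=; lia.
apply/fullP => y; have [_ /affP[x xX ->] xy] := fX (g * y + b).
exists x => //; rewrite -(Gauss_dvdzr _ g_cop).
by have -> : g * (x - y) = g * x + b - (g * y + b) by ring.
Qed.

Lemma card_sum2k_full X :
  (1 < k)%N -> full X -> ((k + 2) * #|` X| <= #|` sum2k X X| + 2 * k)%N.
Proof.
move=> k1 fX; have cX := leq_card_full fX.
have [g [b [A [g0 XA Asp]]]] := aff_normal (leq_trans k1 cX).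
move: fX; rewrite XA => /full_aff fA.
rewrite sum2k_aff !card_aff // mulnDl.
have := card_sum2k_occupied (Asp 2%N isT); suff -> : nclasses A = k by [].
by rewrite -[RHS]card_ord; apply: eq_card => r; apply: (forallP fA).
Qed.

(** If every [2 * x + q] with [x] in [X] were congruent to some [2 * x' + u],
    the residues of [2 * X] would be stable under the generator [q - u] of
    the residues modulo [k]. So the sum with the class of [q] contains a
    translate of that class in a residue class that the sum with the class
    of [u] misses. *)
Lemma card_sumset_not_full X A u q :
  X != fset0 -> ~~ full X -> coprimez k (q - u) ->
  (#|` sum2k X (cl k u A)| + #|` cl k q A| <= #|` sumset (dilate 2 X) A|)%N.
Proof.
move=> X0 nfX cop.
have [|/existsPn stable] := boolP
  [exists x : X, [forall x' : X, ~~ (k%:Z %| 2 * val x + q - (2 * val x' + u))%Z]].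
  case/existsP => [[x xX]] /forallP /= xnew.
  rewrite -(card_sumset_aff u) -(card_aff q (cl k q A) k0).
  rewrite -(@card_aff 1 (2 * x) (aff k%:Z q _)) //.
  apply: leq_add_disjoint.
  - by apply: sumset_sub => //; apply: aff_cl_sub.
  - apply/fsubsetP => _ /affP[y yA ->]; rewrite mul1r addrC mem_sumset ?mem_dilate //.
    by apply: (fsubsetP (aff_cl_sub q A)).
  - move=> _ /sumsetP[_ [_ [/dilateP[x' x'X ->] /affP[y _ ->] ->]]].
    move=> /affP[_ /affP[y' _ ->] E].
    case/negP: (xnew [`x'X]%fset); apply/dvdzP; exists (y - y') => /=.
    by move: E; set a := k%:Z; nia.
(* Starting from [2 * x0], the steps [q - u] reach every residue [2 * y]. *)
case/negP: nfX; apply/fullP => y; have [x0 x0X] := fset0Pn _ X0.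
have reach n : exists2 x, x \in X & (k%:Z %| 2 * x - (2 * x0 + n%:Z * (q - u)))%Z.
  elim: n => [|n [x xX xn]]; first by exists x0; rewrite // mul0r addr0 subrr.
  have := stable [`xX]%fset; rewrite negb_forall => /existsP[[x' x'X]] /=.
  rewrite negbK => xx'; exists x' => //.
  by apply: dvdz_sub xn xx' _; rewrite intS; ring.
have [[v w] /= vw] := coprimezP _ _ cop.
have [n wn] : exists n : nat, (k%:Z %| n%:Z - w * (2 * y - 2 * x0))%Z.
  by have [n nP] := ord_residue (w * (2 * y - 2 * x0)); exists n; rewrite -opprB rpredN.
have [x xX xn] := reach n; exists x => //.
have cop2 : coprimez k 2 by rewrite coprimezE /= coprimen2.
rewrite -(Gauss_dvdzr _ cop2).
have uwn : (k%:Z %| (q - u) * (w * (2 * y - 2 * x0) - n%:Z))%Z.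
  by apply: dvdz_mull; rewrite -opprB rpredN.
apply: (@dvdz_sub _ _
  ((q - u) * (w * (2 * y - 2 * x0) - n%:Z) + v * (2 * y - 2 * x0) * k%:Z) _ xn).
  by rewrite rpredD ?uwn ?dvdz_mull.
have -> : 2 * (x - y) = 2 * x - 2 * x0 - (v * k%:Z + w * (q - u)) * (2 * y - 2 * x0).
  by rewrite vw; ring.
by ring.
Qed.

(** All [k] residue classes of the sum are met using any one class of [A]; when
    that class has a single parity, an element of [A] of the other parity
    supplies the second copy of [X]. *)
Lemma card_sumset_full X A c :
  full X -> spread 2 A -> cl k c A != fset0 ->
  (k * #|` cl k c A| + 2 * #|` X| <= #|` sumset (dilate 2 X) A| + 2 * k)%N.
Proof.
move=> fX Asp; set Z := cl k c A => Z0.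
have Xr0 (r : 'I_k) : cl k r X != fset0 by apply: (forallP fX).
have [z zZ] := fset0Pn _ Z0.
have [|/existsPn par] := boolP [exists y : Z, ~~ (2 %| val y - z)%Z].
  case/existsP => y yz.
  have Zsp : spread 2 Z by exists (val y), z; rewrite (valP y).
  apply: leq_trans (leq_add (card_sumset_cl X A c) (leqnn _)).
  rewrite card_sum2k.
  have bnd (r : 'I_k) :
      (#|` Z| + 2 * #|` cl k r X| <= #|` sumset (dilate 2 (cl k r X)) Z| + 2)%N.
    exact: card_sumset_parity.
  by rewrite [(2 * k)%N]mulnC; apply: leq_sum_residues.
have [b bA bodd] := spread_other (k%:Z * z + c) Asp.
have : (k * #|` Z| + #|` X| <= #|` sum2k X Z| + k)%N.
  have bnd (r : 'I_k) :
      (#|` Z| + 1 * #|` cl k r X| <= #|` sumset (dilate 2 (cl k r X)) Z| + 1)%N.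
    have := card_sumset (dilate_neq0 2 (Xr0 r)) Z0.
    by rewrite card_dilate // addnC mul1n.
  by have := leq_sum_residues bnd; rewrite -card_sum2k mul1n muln1.
rewrite -(card_sumset_aff c).
suff : (#|` sumset (dilate 2 X) (aff k%:Z c Z)| + #|` aff 2 b X|
         <= #|` sumset (dilate 2 X) A|)%N.
  rewrite card_aff //; move: #|` sumset _ (aff _ _ _)| => n; lia.
apply: leq_add_disjoint.
- by apply: sumset_sub => //; apply: aff_cl_sub.
- by apply/fsubsetP => _ /affP[x xX ->]; rewrite mem_sumset ?mem_dilate.
move=> _ /sumsetP[_ [_ [/dilateP[x' x'X ->] /affP[y yZ ->] ->]]] /affP[x _ E].
case/negP: bodd; have := par [`yZ]%fset; rewrite negbK /= => /dvdzP[d yz].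
apply/dvdzP; exists (x' - x + k%:Z * d).
by move: E yz; set a := k%:Z; nia.
Qed.

(** Adds up bounds that hold for each class with the same loss [c], when one
    class [q] does better than the others by [d]. *)
Lemma leq_sum_bonus A (G : 'I_k -> nat) q b c d :
  occupied A q ->
  (forall r, occupied A r -> b * #|` cl k r A| + (r == q) * d <= G r + c)%N ->
  (b * #|` A| + d <= \sum_(r | occupied A r) G r + nclasses A * c)%N.
Proof.
move=> Aq AG.
have : (forall r, occupied A r -> 0 + 1 * (b * #|` cl k r A| + (r == q) * d) <= G r + c)%N.
  by move=> r Ar; rewrite mul1n; apply: AG.
move=> /leq_sum_affine; rewrite muln0 mul1n add0n; apply: leq_trans.
rewrite -(sum_card_occupied A) big_split /= -big_distrr /= leq_add2l.
by rewrite (bigD1 q) //= eqxx mul1n leq_addr.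
Qed.

(** * A bound for all sets, with a large error *)

Variable p : nat.
Hypothesis p_gt1 : (1 < p)%N.
Hypothesis p_dvd : (p %| k)%N.
Hypothesis p_coprime : forall d : int, ~~ (p%:Z %| d)%Z -> coprimez k d.

Let dvd_pk (x : int) : (k%:Z %| x)%Z -> (p%:Z %| x)%Z.
Proof. by apply: dvdz_trans; rewrite dvdzE. Qed.

Let k_gt1 : (1 < k)%N.
Proof. by apply: leq_trans p_gt1 (dvdn_leq _ p_dvd); case: k k_odd. Qed.

Lemma spread_occupied A (r : 'I_k) :
  spread p A -> exists2 q : 'I_k, occupied A q & ~~ (p%:Z %| q%:Z - r%:Z)%Z.
Proof.
move=> Asp; have [a aA ar] := spread_other r Asp.
have [q aq] := ord_residue a; exists q; first by apply/cl_neq0P; exists a.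
apply: contra ar => qr; have := dvd_pk aq => {}aq.
have -> : a - r%:Z = (a - q%:Z) + (q%:Z - r%:Z) by ring.
by rewrite rpredD.
Qed.

Lemma nclasses_gt1 A : spread p A -> (1 < nclasses A)%N.
Proof.
move=> Asp; have [r0 _] := ord_residue 0.
have [r Ar _] := spread_occupied r0 Asp; have [q Aq qr] := spread_occupied r Asp.
apply/card_gt1P; exists r, q; split => //; apply: contra qr => /eqP ->.
by rewrite subrr.
Qed.

(** If [cl k i A] misses a residue, this is [card_sumset_not_full]. Otherwise
    [card_sumset_full], used with the larger of the two classes, gives more than
    enough: its coefficient is [k + 2] in total, while only [m + 1 <= k + 2] is
    required. *)
Lemma class_gain A (m D : nat) (i q : int) :
  spread 2 A -> cl k i A != fset0 -> cl k q A != fset0 ->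
  ~~ (p%:Z %| q - i)%Z -> (m <= k + 1)%N -> (2 * m <= D + 2)%N ->
  (m * #|` cl k i A| <= #|` sum2k (cl k i A) (cl k i A)| + D)%N ->
  (m * #|` cl k i A| + #|` cl k q A|
     <= #|` sumset (dilate 2 (cl k i A)) A| + D)%N.
Proof.
move=> Asp Xi Xq qi mk mD weak.
have [fX|nfX] := boolP (full (cl k i A)); last first.
  by have := card_sumset_not_full A Xi nfX (p_coprime qi); lia.
have := leq_card_full fX.
have := card_sumset_full fX Asp Xi.
have := card_sumset_full fX Asp Xq.
move: #|` sumset _ A| #|` cl k i A| #|` cl k q A| => S x y.
by case: (leqP y x); nia.
Qed.

Lemma card_sum2k_many_classes A m :
  spread 2 A -> (1 < #|` A|)%N -> (m <= nclasses A)%N ->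
  ((m + 2) * #|` A| <= #|` sum2k A A| + 2 * m)%N.
Proof.
move=> Asp cA mj; have := card_sum2k_occupied Asp.
move: mj cA; move: #|` A| #|` sum2k A A| (nclasses A) => N F j /subnKC <-.
nia.
Qed.

Lemma largest_class A :
  exists c : 'I_k, forall r : 'I_k, (#|` cl k r A| <= #|` cl k c A|)%N.
Proof.
have [r0 _] := ord_residue 0.
have [c _ cP] := arg_maxnP (fun r : 'I_k => #|` cl k r A|) (erefl true : xpredT r0).
by exists c => r; apply: cP.
Qed.

(** The block [B] of the classes congruent to [c] modulo [p] keeps its own
    sum, which an induction can bound as a whole; every other class is summed with
    all of [A]. *)
Lemma split_block (A : {fset int}) (c : 'I_k)
    (B := [fset a in A | (p%:Z %| (a - c%:Z)%R)%Z]%fset) :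
  (#|` A| = #|` B| + \sum_(r < k | ~~ (p%:Z %| (r%:Z - c%:Z)%R)%Z) #|` cl k r A|)%N /\
  (#|` sum2k B B| + \sum_(r < k | ~~ (p%:Z %| (r%:Z - c%:Z)%R)%Z)
       #|` sumset (dilate 2 (cl k r A)) A| <= #|` sum2k A A|)%N.
Proof.
have BA : (B `<=` A)%fset by apply/fsubsetP => a; rewrite !inE => /andP[].
have rB (r : 'I_k) : cl k r B = if (p%:Z %| (r%:Z - c%:Z)%R)%Z then cl k r A else fset0.
  have pr z : (p%:Z %| k%:Z * z + r%:Z - c%:Z)%Z = (p%:Z %| (r%:Z - c%:Z)%R)%Z.
    by rewrite -addrA rpredDl // dvd_pk // dvdz_mulr.
  apply/fsetP => z; rewrite mem_cl // !inE /= pr; case: ifP => _.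
    by rewrite andbT mem_cl.
  by rewrite andbF inE.
split.
  rewrite -(sum_card_cl A) -(sum_card_cl B).
  rewrite (bigID (fun r : 'I_k => (p%:Z %| (r%:Z - c%:Z)%R)%Z)) /=; congr (_ + _)%N.
  rewrite [RHS](bigID (fun r : 'I_k => (p%:Z %| (r%:Z - c%:Z)%R)%Z)) /=.
  rewrite [X in (_ = _ + X)%N]big1 ?addn0 => [|r /negbTE rc]; last by rewrite rB rc cardfs0.
  by apply: eq_bigr => r rc; rewrite rB rc.
rewrite (card_sum2k A) (card_sum2k B).
rewrite [leqRHS](bigID (fun r : 'I_k => (p%:Z %| (r%:Z - c%:Z)%R)%Z)) /= leq_add2r.
rewrite [leqLHS](bigID (fun r : 'I_k => (p%:Z %| (r%:Z - c%:Z)%R)%Z)) /=.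
rewrite [X in (_ + X <= _)%N]big1 ?addn0 => [|r /negbTE rc]; last first.
  rewrite rB rc; apply/eqP; rewrite cardfs_eq0; apply/eqP/fsetP => z.
  rewrite inE; apply/negbTE/negP => /sumsetP[_ [_ [/dilateP[x x0 _] _ _]]].
  by rewrite inE in x0.
apply: leq_sum => r rc; rewrite rB rc.
by apply: fsubset_leq_card; apply: sumset_sub.
Qed.

(** Induction on [t], then on the size of [A]. With [t + 3] classes or more,
    [card_sum2k_occupied] suffices. Otherwise let [c] be a largest class, and call
    outer the classes that differ from it modulo [p]. Each outer class gains the
    size of [c]. If every outer class is smaller than [c] by at least the current
    error, this gain pays for that error and raises the coefficient, so the outer
    classes lose nothing, and the remaining block is bounded by the induction on
    size. If some outer class [q] is almost as large as [c], the classes of the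
    block gain the size of [q], which is their own size up to the current error,
    so every class has its coefficient raised at the cost of a bounded loss. *)
Lemma weak_bound t A :
  (t + 2 <= k)%N -> ((t + 4) * #|` A| <= #|` sum2k A A| + weak_error t)%N.
Proof.
elim: t A => [|t IHt] A tk.
  have [cA|cA] := leqP #|` A| 1.
    by have := weak_error_ge 0; nia.
  have [g [b [A' [g0 AA' Asp]]]] := aff_normal cA.
  move: cA; rewrite AA' sum2k_aff !card_aff // => cA.
  have := card_sum2k_many_classes (Asp 2%N isT) cA (nclasses_gt1 (Asp p p_gt1)).
  by have := weak_error_ge 0; lia.
have [n] := ubnP #|` A|; elim: n A => // n IHn A /ltnSE cAn.
have errS := weak_errorS t; have err0 := weak_error_ge t.
have [cA|cA] := leqP #|` A| 1; first by nia.
have [g [b [A' [g0 AA' Asp]]]] := aff_normal cA.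
move: cA cAn; rewrite AA' sum2k_aff !card_aff // => cA cAn {A AA' g b g0}.
have Asp2 := Asp 2%N isT; have Aspp := Asp p p_gt1.
have [jt|jt] := leqP (t + 3) (nclasses A').
  by have := card_sum2k_many_classes Asp2 cA jt; nia.
have [c cmax] := largest_class A'.
have Ac : cl k c A' != fset0.
  have [r Ar _] := spread_occupied c Aspp.
  by rewrite -cardfs_gt0 (leq_trans _ (cmax r)) // cardfs_gt0.
have gain (i q : 'I_k) : occupied A' i -> occupied A' q -> ~~ (p%:Z %| q%:Z - i%:Z)%Z ->
    ((t + 4) * #|` cl k i A'| + #|` cl k q A'|
      <= #|` sumset (dilate 2 (cl k i A')) A'| + weak_error t)%N.
  move=> Ai Aq qi; apply: class_gain => //; [lia | lia | by apply: IHt; lia].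
(* Is some outer class almost as large as the largest one? *)
have [|/existsPn small] := boolP [exists q : 'I_k, [&& ~~ (p%:Z %| (q%:Z - c%:Z)%R)%Z,
    occupied A' q & (#|` cl k c A'| <= #|` cl k q A'| + weak_error t)%N]].
  case/existsP => q /and3P[qc Aq cq].
  have bonus r : occupied A' r -> ((t + 5) * #|` cl k r A'| + (r == q) * weak_error t
      <= #|` sumset (dilate 2 (cl k r A')) A'| + 2 * weak_error t)%N.
    move=> Ar; have [rc|rc] := boolP (p%:Z %| (r%:Z - c%:Z)%R)%Z.
      have rq : (r == q) = false by apply/negbTE; apply: contraNneq qc => <-.
      have qr : ~~ (p%:Z %| q%:Z - r%:Z)%Z.
        apply: contra qc => qr; have -> : q%:Z - c%:Z = (q%:Z - r%:Z) + (r%:Z - c%:Z) by ring.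
        by rewrite rpredD.
      by have := gain _ _ Ar Aq qr; have := cmax r; rewrite rq; lia.
    have cr : ~~ (p%:Z %| c%:Z - r%:Z)%Z by rewrite -opprB rpredN.
    have := gain _ _ Ar Ac cr; have := cmax r.
    by case: (r == q); lia.
  have := leq_sum_bonus Aq bonus; have := sum_occupied_leq A' A' A'.
  rewrite errS; move: (\sum_(_ < _ | _) _)%N => S; nia.
(* All outer classes are small, and the block of [c] is a proper subset. *)
have [cAB sAB] := split_block A' c.
have AB : (#|` [fset a in A' | (p%:Z %| (a - c%:Z)%R)%Z]%fset| < n)%N.
  apply: leq_trans cAn; rewrite cAB -[ltnLHS]addn0 ltn_add2l.
  have [q Aq qc] := spread_occupied c Aspp.
  by rewrite (bigD1 q) //= addn_gt0 cardfs_gt0 (Aq : cl k q A' != fset0).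
have {}IHn := IHn _ AB.
have outside : (\sum_(r < k | ~~ (p%:Z %| (r%:Z - c%:Z)%R)%Z) (t + 5) * #|` cl k r A'|
    <= \sum_(r < k | ~~ (p%:Z %| (r%:Z - c%:Z)%R)%Z) #|` sumset (dilate 2 (cl k r A')) A'|)%N.
  apply: leq_sum => r rc; have [Ar|] := boolP (occupied A' r); last first.
    by rewrite negbK => /eqP ->; rewrite cardfs0 muln0.
  have cr : ~~ (p%:Z %| c%:Z - r%:Z)%Z by rewrite -opprB rpredN.
  have := gain _ _ Ar Ac cr; have := small r; rewrite rc Ar /=; lia.
rewrite -big_distrr /= in outside.
rewrite cAB; move: sAB IHn outside.
move: (\sum_(_ < _ | _) #|` cl _ _ _|)%N (\sum_(_ < _ | _) _)%N => S1 S2.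
move: #|` [fset _ in _ | _]%fset| #|` sum2k A' A'| #|` sumset _ _| => B FA FB.
lia.
Qed.

(** * Extreme elements of the classes *)

Lemma residue_rep_inj (x y : int) (m n : 'I_k) :
  (k%:Z %| x - m%:Z)%Z -> (k%:Z %| y - n%:Z)%Z -> x = y -> m = n.
Proof.
move=> xm yn xy; apply: ord_residue_inj; rewrite -mulrBr dvdz_mull //.
by apply: dvdz_sub yn xm _; rewrite xy; ring.
Qed.

Definition least_in_class (A : {fset int}) (m : 'I_k) (l : int) : Prop :=
  [/\ l \in A, (k%:Z %| l - m%:Z)%Z &
     forall y, y \in cl k m A -> l <= k%:Z * y + m%:Z].

Definition greatest_in_class (A : {fset int}) (m : 'I_k) (l : int) : Prop :=
  [/\ l \in A, (k%:Z %| l - m%:Z)%Z &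
     forall y, y \in cl k m A -> k%:Z * y + m%:Z <= l].

(** Adding [2 * x] for the least [x] of [X] to the least elements of the classes
    of [A] that start before the class of [i] gives as many sums smaller than
    all those counted for the class of [i] alone; symmetrically above. *)
Lemma card_sumset_extremes A (lo hi : 'I_k -> int) (i : 'I_k) (X := cl k i A) :
  (forall m, occupied A m -> least_in_class A m (lo m)) ->
  (forall m, occupied A m -> greatest_in_class A m (hi m)) ->
  occupied A i ->
  (#|` sum2k X X| + #|[pred m | occupied A m && (lo m < lo i)%R]|
     + #|[pred m | occupied A m && (hi i < hi m)%R]|
     <= #|` sumset (dilate 2 X) A|)%N.
Proof.
move=> loP hiP Ai; have X0 : X != fset0 by [].
have [x0 x0X x0min] := fset_min X0; have [x1 x1X x1max] := fset_max X0.
pose U := sumset (dilate 2 X) (aff k%:Z i X).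
set PL := [pred m | _ && (lo m < lo i)]; set PH := [pred m | _ && (hi i < hi m)].
pose L := [fset (2 * x0 + lo m)%R | m in PL]%fset.
pose H := [fset (2 * x1 + hi m)%R | m in PH]%fset.
have cL : #|` L| = #|PL|.
  rewrite card_in_imfset ?cardE // => m n /andP[Am _] /andP[An _] /addrI.
  by have [_ m1 _] := loP m Am; have [_ n1 _] := loP n An; apply: residue_rep_inj m1 n1.
have cH : #|` H| = #|PH|.
  rewrite card_in_imfset ?cardE // => m n /andP[Am _] /andP[An _] /addrI.
  by have [_ m1 _] := hiP m Am; have [_ n1 _] := hiP n An; apply: residue_rep_inj m1 n1.
rewrite -cL -cH -(card_sumset_aff i) -/U.
have ULle : (#|` U| + #|` L| <= #|` U `|` L|%fset)%N.
  apply: leq_add_disjoint; rewrite ?fsubsetUl ?fsubsetUr // => z.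
  move=> /sumsetP[_ [_ [/dilateP[x xX ->] /affP[y yX ->] ->]]] /imfsetP[m /andP[_ ml] E].
  have [_ _ loi] := loP i Ai; have := loi y yX; have := x0min x xX; lia.
apply: leq_trans (leq_add ULle (leqnn _)) _.
apply: leq_add_disjoint.
- rewrite fsubUset; apply/andP; split; first by apply: sumset_sub => //; apply: aff_cl_sub.
  apply/fsubsetP => _ /imfsetP[m /andP[Am _] ->].
  by have [lA _ _] := loP m Am; rewrite mem_sumset ?mem_dilate.
- apply/fsubsetP => _ /imfsetP[m /andP[Am _] ->].
  by have [hA _ _] := hiP m Am; rewrite mem_sumset ?mem_dilate.
have [_ _ hii] := hiP i Ai; have [_ _ loi] := loP i Ai.
move=> z; rewrite inE => /orP[].
  move=> /sumsetP[_ [_ [/dilateP[x xX ->] /affP[y yX ->] ->]]] /imfsetP[m /andP[_ mh] E].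
  by have := hii y yX; have := x1max x xX; lia.
move=> /imfsetP[m /andP[_ ml] ->] /imfsetP[n /andP[_ nh] E].
have := hii x0 x0X; have := loi x0 x0X; have := x0min x1 x1X; lia.
Qed.

Lemma least_in_class_ex A : exists lo : 'I_k -> int,
  forall m, occupied A m -> least_in_class A m (lo m).
Proof.
have kp : 0 < k%:Z by rewrite lt_neqAle eq_sym k0.
apply: (fin_all_exists (P := fun m l => occupied A m -> least_in_class A m l)) => m.
have [Am|] := boolP (occupied A m); last by exists 0.
have [x xA xmin] := fset_min Am; exists (k%:Z * x + m%:Z) => _.
split; [by rewrite -mem_cl | by rewrite addrK dvdz_mulr |].
by move=> y /xmin; rewrite lerD2r ler_pM2l.
Qed.

Lemma greatest_in_class_ex A : exists hi : 'I_k -> int,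
  forall m, occupied A m -> greatest_in_class A m (hi m).
Proof.
have kp : 0 < k%:Z by rewrite lt_neqAle eq_sym k0.
apply: (fin_all_exists (P := fun m l => occupied A m -> greatest_in_class A m l)) => m.
have [Am|] := boolP (occupied A m); last by exists 0.
have [x xA xmax] := fset_max Am; exists (k%:Z * x + m%:Z) => _.
split; [by rewrite -mem_cl | by rewrite addrK dvdz_mulr |].
by move=> y /xmax; rewrite lerD2r ler_pM2l.
Qed.

(** Class by class the loss is [2 * k] by [card_sum2k_full]. Over all classes,
    the sums below and those above each number [j * (j - 1) / 2], where [j] is
    the number of classes: an ordered pair of classes contributes exactly when its
    least, or its greatest, elements are in the right order. *)
Lemma card_sum2k_full_classes A :
  (forall r : 'I_k, occupied A r -> full (cl k r A)) ->
  ((k + 2) * #|` A| + nclasses A * nclasses A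
     <= #|` sum2k A A| + nclasses A * (2 * k + 1))%N.
Proof.
move=> fA; have [lo loP] := least_in_class_ex A; have [hi hiP] := greatest_in_class_ex A.
pose below i := #|[pred m | occupied A m && (lo m < lo i)%R]|.
pose above i := #|[pred m | occupied A m && (hi i < hi m)%R]|.
have cb : (2 * (\sum_(i | occupied A i) below i) + nclasses A
    = nclasses A * nclasses A)%N.
  apply: (sum_card_tournament (R := fun m i => lo m < lo i)) => i m Ai Am.
  have [_ li _] := loP i Ai; have [_ lm _] := loP m Am.
  have [-> | mi] := eqVneq m i; first by rewrite ltxx.
  by case: ltgtP => // /(residue_rep_inj lm li) E; rewrite E eqxx in mi.
have ca : (2 * (\sum_(i | occupied A i) above i) + nclasses A
    = nclasses A * nclasses A)%N.
  apply: (sum_card_tournament (R := fun m i => hi i < hi m)) => i m Ai Am.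
  have [_ li _] := hiP i Ai; have [_ lm _] := hiP m Am.
  have [-> | mi] := eqVneq m i; first by rewrite ltxx.
  by case: ltgtP => // /(residue_rep_inj li lm) E; rewrite E eqxx in mi.
have total : ((k + 2) * #|` A|
      + (\sum_(r | occupied A r) below r + \sum_(r | occupied A r) above r)
    <= \sum_(r < k | occupied A r) #|` sumset (dilate 2 (cl k r A)) A|
      + nclasses A * (2 * k))%N.
  have <- : (\sum_(r < k | occupied A r) 2 * k = nclasses A * (2 * k))%N.
    by rewrite sum_nat_const.
  rewrite -(sum_card_occupied A) big_distrr -!big_split.
  apply: leq_sum => r Ar.
  have combine a f b c e d : (a <= f + d -> f + b + c <= e -> a + (b + c) <= e + d)%N.
    by lia.
  exact: combine (card_sum2k_full k_gt1 (fA r Ar)) (card_sumset_extremes loP hiP Ar).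
have combine N S F b a j : (2 * b + j = j * j -> 2 * a + j = j * j ->
    N + (b + a) <= S + j * (2 * k) -> S <= F -> N + j * j <= F + j * (2 * k + 1))%N.
  lia.
exact: combine cb ca total (sum_occupied_leq A A A).
Qed.

(** * Large sets *)

(** The class of [i] gains the size of a class [q] that differs from it modulo
    [p]. If [q] is too small for this to outweigh the errors of all the classes,
    then the sum of [q] with the whole of [A], which has at least as many elements
    as [A], exceeds by far the [(k + 2) * |q|] elements expected from it. *)
Lemma card_sum2k_not_full_class A (i : 'I_k) :
  spread 2 A -> spread p A -> (8 * k ^ k < #|` A|)%N -> (nclasses A < k)%N ->
  occupied A i -> ~~ full (cl k i A) ->
  ((k + 2) * #|` A| <= #|` sum2k A A|)%N.
Proof.
move=> Asp2 Aspp Alarge jk Ai nfi.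
set D := weak_error (k - 2); set j := nclasses A in jk *.
have weak X : ((k + 2) * #|` X| <= #|` sum2k X X| + D)%N.
  have k2 : (k - 2 + 2 <= k)%N by rewrite subnK.
  by have := weak_bound X k2; rewrite -/D; lia.
have D_large : (k ^ 2 * D < #|` A|)%N.
  apply: leq_ltn_trans Alarge.
  have -> : (k ^ k = k ^ (k - 2) * k ^ 2)%N by rewrite -expnD subnK.
  by have := weak_error_le (k - 2)%N; rewrite -/D subnK //; nia.
have D_gt0 : (6 <= D)%N by have := weak_error_ge (k - 2)%N; rewrite -/D; lia.
have loss r : ((k + 2) * #|` cl k r A| <= #|` sumset (dilate 2 (cl k r A)) A| + D)%N.
  by have := card_sumset_cl (cl k r A) A r; have := weak (cl k r A); lia.
have := sum_occupied_leq A A A.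
have [q Aq qi] := spread_occupied i Aspp.
have [jq|jq] := leqP (j * D) #|` cl k q A|.
  have bonus r : occupied A r -> ((k + 2) * #|` cl k r A| + (r == i) * #|` cl k q A|
      <= #|` sumset (dilate 2 (cl k r A)) A| + D)%N.
    move=> Ar; have [->|_] := eqVneq r i; last by rewrite addn0 loss.
    have := card_sumset_not_full A (Ai : cl k i A != fset0) nfi (p_coprime qi).
    by have := weak (cl k i A); lia.
  by have := leq_sum_bonus Ai bonus; rewrite -/j; lia.
have bonus r : occupied A r -> ((k + 2) * #|` cl k r A| + (r == q) * (j * D)
    <= #|` sumset (dilate 2 (cl k r A)) A| + D)%N.
  move=> Ar; have [->|_] := eqVneq r q; last by rewrite addn0 loss.
  have := card_sumset_parity (Aq : cl k q A != fset0) Asp2.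
  have : (k * #|` cl k q A| <= k * (j * D))%N by rewrite leq_mul2l ltnW ?orbT.
  have : (j.+1 * D <= k * D)%N by rewrite leq_mul2r jk orbT.
  move: D_large; nia.
by have := leq_sum_bonus Aq bonus; rewrite -/j; lia.
Qed.

(** In the last case, with [j <= k - 1] classes, the loss [j * (2 * k + 1 - j)]
    increases with [j]. *)
Lemma card_sum2k_large A :
  (8 * k ^ k < #|` A|)%N ->
  ((k + 2) * #|` A| + 2 <= #|` sum2k A A| + k * k + k)%N.
Proof.
move=> Alarge; have k3 : (3 <= k)%N by move: k_gt1 k_odd; case: k => [|[|[|]]].
have A1 : (1 < #|` A|)%N.
  by apply: leq_trans Alarge; have := expn_gt0 k k; lia.
have [g [b [A' [g0 AA' Asp]]]] := aff_normal A1.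
move: Alarge; rewrite AA' sum2k_aff !card_aff // => Alarge.
have Asp2 := Asp 2%N isT; have Aspp := Asp p p_gt1.
have jk : (nclasses A' <= k)%N by rewrite -[leqRHS](card_ord k) max_card.
have [{}jk|kj] := ltnP (nclasses A') k; last first.
  have := card_sum2k_occupied Asp2.
  have -> : nclasses A' = k by apply/eqP; rewrite eqn_leq jk.
  by nia.
have [/existsP[i /andP[Ai nfi]] | /existsPn nex] :=
    boolP [exists i : 'I_k, occupied A' i && ~~ full (cl k i A')].
  by have := card_sum2k_not_full_class Asp2 Aspp Alarge jk Ai nfi; lia.
have fA (r : 'I_k) : occupied A' r -> full (cl k r A').
  by move=> Ar; have := nex r; rewrite Ar negbK.
have := card_sum2k_full_classes fA.
move: jk; move: (nclasses A') => j jk.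
have [d ->] : exists d, k = (j + d.+1)%N by exists (k - j.+1)%N; lia.
nia.
Qed.

End Residues.

Theorem theorem1 (p alpha k : nat) (A : {fset int})
    (p_prime : prime p) (p_odd : odd p) (alpha_ge1 : (1 <= alpha)%N)
    (k_def : k = (p ^ alpha)%N)
    (A_large : (8 * k ^ k < #|` A |)%N) :
  (k%:Z + 2) * #|` A |%:Z - k%:Z ^+ 2 - k%:Z + 2
    <= #|` sumset (dilate 2 A) (dilate k%:Z A) |%:Z.
Proof.
have k_odd : odd k by rewrite k_def oddX p_odd orbT.
have p_dvd : (p %| k)%N by rewrite k_def dvdn_exp.
have p_coprime d : ~~ (p%:Z %| d)%Z -> coprimez k d.
  by rewrite dvdzE coprimezE k_def coprime_pexpl //= prime_coprime.
have := card_sum2k_large k_odd (prime_gt1 p_prime) p_dvd p_coprime A_large.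
move: #|` sumset _ _| #|` A| => F N; rewrite expr2; nia.
Qed.
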